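(* Let $m,n\in\mathbb N$ be standard and let $\mathcal A$ be an $m\times n$ matrix over $\mathbb E$. If $\operatorname{sr}(\mathcal A)=r$ (i.e. the strict rank of $\mathcal A$ is defined and equal to $r$), then $\operatorname{mr}(\mathcal A)=r(\mathcal A)=r$.
   Context: We work in nonstandard analysis with external sets (the theory HST of Kanovei and Reeken, extending a bounded form of Nelson's IST), so $\mathbb R$ contains nonstandard numbers. A neutrix is a convex additive subgroup of $\mathbb R$ (possibly an external set). An external number is a set $\alpha=a+A=\{a+x: x\in A\}$ with $a\in\mathbb R$ and $A$ a neutrix; $\mathbb E$ is the class of external numbers. $\alpha$ is zeroless if $0\notin\alpha$; otherwise $\alpha$ is a neutrix. Operations are Minkowski operations: $(a+A)\pm(b+B)=(a\pm b)+(A+B)$, $(a+A)(b+B)=ab+aB+bA+AB$. The determinant of a $k\times k$ matrix over $\mathbb E$ is $\sum_{\sigma\in S_k}\operatorname{sgn}(\sigma)\alpha_{1\sigma(1)}\cdots\alpha_{k\sigma(k)}$; a minor of order $k$ of $\mathcal A$ is the determinant of a $k\times k$ submatrix. A neutrix vector is a vector all of whose coordinates are neutrices. A set $\{\xi_1,\dots,\xi_p\}$ of vectors of $\mathbb E^n$ is linearly dependent if there exist real numbers $t_1,\dots,t_p$, not all zero, and a neutrix vector $A$ with $t_1\xi_1+\cdots+t_p\xi_p=A$; otherwise it is linearly independent. The row-rank $r(\mathcal A)$ is the maximal cardinality of a linearly independent subset of the set of row vectors of $\mathcal A$ (for real matrices this is the usual rank). The minor-rank $\operatorname{mr}(\mathcal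 A)$ is the largest natural number $k$ such that $\mathcal A$ has a zeroless minor of order $k$ ($0$ if there is none). A representative matrix of $\mathcal A=(\alpha_{ij})$ is a real matrix $\hat{\mathcal A}=(a_{ij})$ with $a_{ij}\in\alpha_{ij}$ for all $i,j$. If there exists a representative matrix $\hat{\mathcal A}$ of $\mathcal A$ whose (usual) rank equals $\operatorname{mr}(\mathcal A)$, then the minor-rank is called a strict rank and denoted $\operatorname{sr}(\mathcal A)$; otherwise the strict rank is not defined. *)

(* Defs.v *)
From HB Require Import structures.
From mathcomp Require Import all_boot all_order all_fingroup all_algebra finmap.
From mathcomp Require Import boolp classical_sets reals.

Set Implicit Arguments.
Unset Strict Implicit.
Unset Printing Implicit Defensive.

Import Order.TTheory GRing.Theory Num.Theory.
Local Open Scope classical_set_scope.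
Local Open Scope ring_scope.

(* The nonstandard real line: a real closed field R properly extending a field
   S of standard reals. By Tarski's theorem such an embedding is automatically
   elementary for the language of ordered fields, i.e. Transfer holds. The
   internal reals of a model of HST are of this kind; the external sets of
   reals are then among the elements of [set R], and the standard natural
   numbers are the elements of [nat]. *)
Definition nonstandard_reals (R : rcfType) : Prop :=
  exists (S : realType) (st : {rmorphism S -> R}),
    exists x : R, forall s : S, st s <> x.

Section ExternalNumbers.
Variable R : rcfType.
Implicit Types (X Y A B N : set R) (a b c t x y z : R).

Definition is_neutrix A : Prop :=
  [/\ A 0,
      forall x y, A x -> A y -> A (x - y)
    & forall x y z, A x -> A z -> x <= y <= z -> A y].

Definition is_external X : Prop :=
  exists a A, is_neutrix A /\ X = [set a + x | x in A].

Definition mink_add X Y : set R := [set x + y | x in X & y in Y].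
Definition mink_mul X Y : set R := [set x * y | x in X & y in Y].

Lemma is_neutrix_sym_convex A :
    A !=set0 -> (forall x y, A x -> A y -> A (x + y)) ->
    (forall x y, A x -> `|y| <= `|x| -> A y) ->
  is_neutrix A.
Proof.
move=> [x0 Ax0] AD An; split.
- by apply: (An x0) => //; rewrite normr0.
- by move=> x y Ax Ay; apply: AD => //; apply: (An y) => //; rewrite normrN.
move=> x y z Ax Az /andP[xy yz].
have [y0|y0] := lerP 0 y.
  by apply: (An z) => //; rewrite !ger0_norm// (le_trans y0).
apply: (An x) => //; rewrite !ltr0_norm ?lerN2//.
exact: le_lt_trans y0.
Qed.

Lemma neutrixN A x : is_neutrix A -> A x -> A (- x).
Proof. by move=> [A0 AB _] Ax; rewrite -sub0r; apply: AB. Qed.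

Lemma neutrixD A x y : is_neutrix A -> A x -> A y -> A (x + y).
Proof.
move=> nA Ax Ay; have [_ AB _] := nA.
by rewrite -[y]opprK; apply: AB => //; apply: neutrixN.
Qed.

Lemma neutrix_norm A x y : is_neutrix A -> A x -> `|y| <= `|x| -> A y.
Proof.
move=> nA Ax yx; have [_ _ AC] := nA.
have Ax' : A `|x| by case: (ger0P x) => // _; apply: neutrixN.
apply: (AC (- `|x|) y `|x|) => //; first exact: neutrixN.
by rewrite -ler_norml.
Qed.

Lemma neutrix_notin A a x : is_neutrix A -> ~ A a -> A x -> `|x| < `|a|.
Proof.
by move=> nA Aa Ax; rewrite ltNge; apply/negP => /(neutrix_norm nA Ax).
Qed.

Lemma is_neutrix0 : is_neutrix [set 0].
Proof.
apply: is_neutrix_sym_convex; first by exists 0.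
  by move=> x y /= -> ->; rewrite addr0.
by move=> x y /= ->; rewrite normr0 normr_le0 => /eqP.
Qed.

Lemma is_neutrixD A B :
  is_neutrix A -> is_neutrix B -> is_neutrix (mink_add A B).
Proof.
move=> nA nB; apply: is_neutrix_sym_convex.
- by have [A0 _ _] := nA; have [B0 _ _] := nB; exists (0 + 0), 0 => //; exists 0.
- move=> _ _ [x Ax [y By <-]] [x' Ax' [y' By' <-]].
  exists (x + x'); first exact: neutrixD.
  by exists (y + y'); [exact: neutrixD | rewrite addrACA].
move=> _ z [x Ax [y By <-]] zxy.
have [yx|/ltW xy] := lerP `|y| `|x|.
  have z2 : `|z / 2%:R| <= `|x|.
    rewrite normrM normfV (@ger0_norm _ 2%:R)// ler_pdivrMr//.
    apply: le_trans zxy _; apply: le_trans (ler_normD _ _) _.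
    by rewrite mulr_natr mulr2n lerD2l.
  exists z; last by exists 0; rewrite ?addr0//; case: nB.
  rewrite [z]splitr.
  by apply: neutrixD => //; apply: neutrix_norm z2.
have z2 : `|z / 2%:R| <= `|y|.
  rewrite normrM normfV (@ger0_norm _ 2%:R)// ler_pdivrMr//.
  apply: le_trans zxy _; apply: le_trans (ler_normD _ _) _.
  by rewrite mulr_natr mulr2n lerD2r.
exists 0; first by case: nA.
exists z; rewrite ?add0r//.
rewrite [z]splitr.
by apply: neutrixD => //; apply: neutrix_norm z2.
Qed.

Lemma is_neutrixM A B :
  is_neutrix A -> is_neutrix B -> is_neutrix (mink_mul A B).
Proof.
move=> nA nB.
have norm x y z : A x -> B y -> `|z| <= `|x * y| -> mink_mul A B z.
  move=> Ax By zxy; have [x0|x0] := eqVneq x 0.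
    move: zxy; rewrite x0 mul0r normr0 normr_le0 => /eqP ->.
    by exists 0; [case: nA | exists y; rewrite ?mul0r].
  exists x => //; exists (z / x); last by rewrite mulrC divfK.
  apply: neutrix_norm By _ => //.
  by rewrite normrM normfV ler_pdivrMr ?normr_gt0// mulrC -normrM.
apply: is_neutrix_sym_convex.
- by have [A0 _ _] := nA; have [B0 _ _] := nB; exists (0 * 0), 0 => //; exists 0.
- move=> _ _ [x Ax [y By <-]] [x' Ax' [y' By' <-]].
  have [u [Au ux ux']] : exists u, [/\ A u, `|x| <= `|u| & `|x'| <= `|u|].
    by have [h|/ltW h] := lerP `|x| `|x'|; [exists x' | exists x].
  have [v [Bv vy vy']] : exists v, [/\ B v, `|y| <= `|v| & `|y'| <= `|v|].
    by have [h|/ltW h] := lerP `|y| `|y'|; [exists y' | exists y].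
  apply: (norm u (v + v)); rewrite ?Au//; first exact: neutrixD.
  apply: le_trans (ler_normD _ _) _.
  rewrite mulrDr -mulr2n normrMn mulr2n !normrM.
  by apply: lerD; apply: ler_pM.
by move=> _ z [x Ax [y By <-]]; apply: norm.
Qed.

Lemma is_neutrix_scale a B :
  is_neutrix B -> is_neutrix [set a * y | y in B].
Proof.
move=> nB; apply: is_neutrix_sym_convex.
- by have [B0 _ _] := nB; exists (a * 0), 0.
- move=> _ _ [y By <-] [y' By' <-].
  by exists (y + y'); [exact: neutrixD | rewrite mulrDr].
move=> _ z [y By <-] zay; have [a0|a0] := eqVneq a 0.
  move: zay; rewrite a0 mul0r normr0 normr_le0 => /eqP ->.
  by exists y; rewrite ?mul0r.
exists (z / a); last by rewrite mulrC divfK.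
apply: neutrix_norm By _ => //.
by rewrite normrM normfV ler_pdivrMr ?normr_gt0// mulrC -normrM.
Qed.

(* (a + A) + (b + B) = (a + b) + (A + B) *)
Lemma mink_addE a b A B :
  mink_add [set a + x | x in A] [set b + y | y in B]
  = [set (a + b) + z | z in mink_add A B].
Proof.
apply/seteqP; split => [_ [_ [x Ax <-] [_ [y By <-] <-]]|].
  by exists (x + y); [exists x => //; exists y | rewrite addrACA].
move=> _ [_ [x Ax [y By <-]] <-].
by exists (a + x); [exists x | exists (b + y); [exists y | rewrite addrACA]].
Qed.

Lemma mink_mulC X Y : mink_mul X Y = mink_mul Y X.
Proof.
by apply/seteqP; split => _ [x Xx [y Yy <-]]; exists y => //; exists x => //;
  rewrite mulrC.
Qed.

Lemma mink_addC X Y : mink_add X Y = mink_add Y X.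
Proof.
by apply/seteqP; split => _ [x Xx [y Yy <-]]; exists y => //; exists x => //;
  rewrite addrC.
Qed.

(* (a + A) (b + B) = ab + (aB + bA + AB) *)
Lemma mink_mulE a b A B : is_neutrix A -> is_neutrix B ->
  mink_mul [set a + x | x in A] [set b + y | y in B]
  = [set a * b + z | z in mink_add (mink_add [set a * y | y in B]
                                             [set b * x | x in A])
                                   (mink_mul A B)].
Proof.
move=> nA nB; apply/seteqP; split => [_ [_ [x Ax <-] [_ [y By <-] <-]]|].
  exists (a * y + b * x + x * y).
    exists (a * y + b * x); last by exists (x * y) => //; exists x => //; exists y.
    by exists (a * y); [exists y | exists (b * x) => //; exists x].
  by rewrite mulrDl !mulrDr !addrA (mulrC x b).
move=> _ [_ [_ [_ [y By <-] [_ [x Ax <-] <-]] [_ [x' Ax' [y' By' <-]] <-]] <-].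
have inA c C : is_neutrix C -> C c -> forall u, C u -> exists2 w, C w & c + w = u.
  move=> [_ CB _] Cc u Cu; exists (u - c); first exact: CB.
  by rewrite addrC subrK.
(* the two cases where one factor is a neutrix *)
have key c d C D u v u' v' : is_neutrix C -> is_neutrix D -> C c ->
    C u -> D v -> C u' -> D v' ->
    exists2 w, C w & exists2 e, D e &
      (c + w) * (d + e) = c * d + (c * v + d * u + u' * v').
  move=> nC nD Cc Cu Dv Cu' Dv'.
  have [p [q [Cp Dq pq]]] : exists p q, [/\ C p, D q & c * v + u' * v' = p * q].
    have [_ + _] := is_neutrixM nC nD; move=> /(_ (c * v) (- (u' * v'))) [].
    - by exists c => //; exists v.
    - by exists (- u'); [exact: neutrixN | exists v' => //; rewrite mulNr].
    by move=> p Cp [q Dq pqE]; exists p, q; split=> //; rewrite pqE opprK.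
  have -> : c * d + (c * v + d * u + u' * v') = d * (c + u) + p * q.
    by rewrite -pq mulrDr (mulrC d c) -!addrA; congr (_ + _); rewrite addrCA.
  have Ccu : C (c + u) by exact: neutrixD.
  have [Dd|Dd] := pselect (D d).
    have [_ + _] := is_neutrixM nC nD.
    move=> /(_ ((c + u) * d) (- (p * q))) [].
    - by exists (c + u) => //; exists d.
    - by exists (- p); [exact: neutrixN | exists q => //; rewrite mulNr].
    move=> p' Cp' [q' Dq' E].
    have [w Cw wE] := inA c C nC Cc p' Cp'.
    have [e De Ee] := inA d D nD Dd q' Dq'.
    by exists w => //; exists e => //; rewrite wE Ee E opprK (mulrC d).
  have qd := neutrix_notin nD Dd Dq.
  have d0 : d != 0 by rewrite -normr_gt0; apply: le_lt_trans qd.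
  have [w Cw E] : exists2 w, C w & c + w = c + u + p * q / d.
    apply: inA => //; apply: neutrixD => //; apply: neutrix_norm Cp _ => //.
    rewrite !normrM normfV ler_pdivrMr ?normr_gt0//.
    by apply: ler_wpM2l => //; apply: ltW.
  exists w => //; exists 0; first by case: nD.
  by rewrite E addr0 mulrDl divfK// (mulrC d).
have [Aa|Aa] := pselect (A a).
  have [w Aw [e Be E]] := key a b A B x y x' y' nA nB Aa Ax By Ax' By'.
  exists (a + w); first by exists w.
  by exists (b + e); [exists e|].
have [Bb|Bb] := pselect (B b).
  have [w Bw [e Ae E]] := key b a B A y x y' x' nB nA Bb By Ax By' Ax'.
  exists (a + e); first by exists e.
  exists (b + w); first by exists w.
  by rewrite mulrC E (mulrC b a) (mulrC y') (addrC (b * x)).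
have xa' := neutrix_notin nA Aa Ax'.
have a0 : a != 0 by rewrite -normr_gt0; apply: le_lt_trans xa'.
have yb := neutrix_notin nB Bb By.
have b0 : b != 0 by rewrite -normr_gt0; apply: le_lt_trans yb.
have [y2 By2 E2] : exists2 y2, B y2 & a * y + x' * y' = a * y2.
  exists (y + x' * y' / a); last by rewrite mulrDr mulrC [a * (_ / a)]mulrC divfK// mulrC.
  apply: neutrixD => //; apply: neutrix_norm By' _ => //.
  rewrite !normrM normfV ler_pdivrMr ?normr_gt0// mulrC.
  by apply: ler_wpM2l => //; apply: ltW.
have -> : a * y + b * x + x' * y' = a * y2 + b * x by rewrite -E2 addrAC.
have [h|/ltW h] := lerP `|a * y2| `|b * x|.
  exists (a + (a * y2 + b * x) / b).
    exists ((a * y2 + b * x) / b) => //.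
    rewrite mulrDl [b * x]mulrC mulfK//; apply: neutrixD => //.
    apply: neutrix_norm Ax _ => //.
    by rewrite normrM normfV ler_pdivrMr ?normr_gt0// -normrM [x * b]mulrC.
  exists (b + 0); first by exists 0 => //; case: nB.
  by rewrite addr0 mulrDl divfK.
exists (a + 0); first by exists 0 => //; case: nA.
exists (b + (a * y2 + b * x) / a).
  exists ((a * y2 + b * x) / a) => //.
  rewrite mulrDl [a * y2]mulrC mulfK//; apply: neutrixD => //.
  apply: neutrix_norm By2 _ => //.
  by rewrite normrM normfV ler_pdivrMr ?normr_gt0// -normrM [y2 * a]mulrC.
by rewrite addr0 mulrDr [a * (_ / a)]mulrC divfK.
Qed.

Lemma is_externalD X Y :
  is_external X -> is_external Y -> is_external (mink_add X Y).
Proof.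
move=> [a [A [nA ->]]] [b [B [nB ->]]].
exists (a + b), (mink_add A B); split; [exact: is_neutrixD|exact: mink_addE].
Qed.

Lemma is_externalM X Y :
  is_external X -> is_external Y -> is_external (mink_mul X Y).
Proof.
move=> [a [A [nA ->]]] [b [B [nB ->]]].
eexists _, _; split; last exact: mink_mulE.
by apply: is_neutrixD; [apply: is_neutrixD; exact: is_neutrix_scale
                       | exact: is_neutrixM].
Qed.

Lemma is_external1 a : is_external [set a].
Proof.
exists a, [set 0]; split; first exact: is_neutrix0.
by rewrite image_set1 addr0.
Qed.

Record extnum := ExtNum { ext_set :> set R; extnumP : is_external ext_set }.

Lemma ext_set_inj : injective ext_set.
Proof.
by move=> [X hX] [Y hY] /= XY; subst Y; congr ExtNum; exact: Prop_irrelevance.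
Qed.

HB.instance Definition _ := gen_eqMixin extnum.
HB.instance Definition _ := gen_choiceMixin extnum.

Definition ext_add (al be : extnum) : extnum :=
  ExtNum (is_externalD (extnumP al) (extnumP be)).
Definition ext_mul (al be : extnum) : extnum :=
  ExtNum (is_externalM (extnumP al) (extnumP be)).
Definition ext_real (a : R) : extnum := ExtNum (is_external1 a).

Lemma ext_addA : associative ext_add.
Proof.
move=> al be ga; apply: ext_set_inj; apply/seteqP; split => /=.
  move=> _ [x hx [_ [y hy [z hz <-]] <-]].
  by exists (x + y); [exists x => //; exists y | exists z; rewrite ?addrA].
move=> _ [_ [x hx [y hy <-]] [z hz <-]].
by exists x => //; exists (y + z); [exists y => //; exists z | rewrite addrA].
Qed.

Lemma ext_addC : commutative ext_add.
Proof. by move=> al be; apply: ext_set_inj; exact: mink_addC. Qed.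

Lemma ext_add0 : left_id (ext_real 0) ext_add.
Proof.
move=> al; apply: ext_set_inj; apply/seteqP; split => /=.
  by move=> _ [_ -> [y hy <-]]; rewrite add0r.
by move=> y hy; exists 0 => //; exists y; rewrite ?add0r.
Qed.

Lemma ext_mulA : associative ext_mul.
Proof.
move=> al be ga; apply: ext_set_inj; apply/seteqP; split => /=.
  move=> _ [x hx [_ [y hy [z hz <-]] <-]].
  by exists (x * y); [exists x => //; exists y | exists z; rewrite ?mulrA].
move=> _ [_ [x hx [y hy <-]] [z hz <-]].
by exists x => //; exists (y * z); [exists y => //; exists z | rewrite mulrA].
Qed.

Lemma ext_mulC : commutative ext_mul.
Proof. by move=> al be; apply: ext_set_inj; exact: mink_mulC. Qed.

Lemma ext_mul1 : left_id (ext_real 1) ext_mul.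
Proof.
move=> al; apply: ext_set_inj; apply/seteqP; split => /=.
  by move=> _ [_ -> [y hy <-]]; rewrite mul1r.
by move=> y hy; exists 1 => //; exists y; rewrite ?mul1r.
Qed.

(* Only subdistributivity holds, so extnum is not a semiring: sums use the
   additive monoid structure, products the monoid law ext_mul. *)
HB.instance Definition _ :=
  GRing.isNmodule.Build extnum ext_addA ext_addC ext_add0.
HB.instance Definition _ :=
  Monoid.isComLaw.Build extnum (ext_real 1) ext_mul ext_mulA ext_mulC ext_mul1.

Definition zeroless (al : extnum) : Prop := ~ ext_set al 0.

Definition ext_det k (M : 'M[extnum]_k) : extnum :=
  \sum_(s : 'S_k)
    ext_mul (ext_real ((-1) ^+ s))
            (\big[ext_mul/ext_real 1]_(i < k) M i (s i)).

Definition neutrix_vector n (v : 'rV[extnum]_n) : Prop :=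
  forall j, is_neutrix (v ord0 j).

Definition ext_scale n (t : R) (v : 'rV[extnum]_n) : 'rV[extnum]_n :=
  \row_j ext_mul (ext_real t) (v ord0 j).

Definition lin_dependent n (V : {fset 'rV[extnum]_n}) : Prop :=
  exists t : 'rV[extnum]_n -> R,
    (exists2 xi, xi \in V & t xi != 0) /\
    exists2 A : 'rV[extnum]_n,
      neutrix_vector A & \sum_(xi <- V) ext_scale (t xi) xi = A.

Definition lin_independent n (V : {fset 'rV[extnum]_n}) : Prop :=
  ~ lin_dependent V.

Section Ranks.
Variables (m n : nat) (M : 'M[extnum]_(m, n)).

Definition row_set : {fset 'rV[extnum]_n} := [fset row i M | i : 'I_m]%fset.

Definition row_rank : nat :=
  \max_(V <- fpowerset row_set | `[< lin_independent V >]) #|` V|.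

(* Strictly increasing row and column selections. *)
Definition has_zeroless_minor (k : nat) : Prop :=
  exists (f : 'I_k -> 'I_m) (g : 'I_k -> 'I_n),
    [/\ {homo f : i j / (i < j)%N}, {homo g : i j / (i < j)%N}
      & zeroless (ext_det (mxsub f g M))].

(* There is no k x k submatrix for k > minn m n. *)
Definition minor_rank : nat :=
  \max_(k < (minn m n).+1 | `[< has_zeroless_minor k >]) k.

Definition is_representative (P : 'M[R]_(m, n)) : Prop :=
  forall i j, ext_set (M i j) (P i j).

(* None when the strict rank is not defined. *)
Definition strict_rank : option nat :=
  if `[< exists2 P, is_representative P & \rank P = minor_rank >]
  then Some minor_rank else None.

End Ranks.
End ExternalNumbers.

(* Main.v *)
Require Import Defs.
From mathcomp Require Import all_boot all_order all_algebra.
From mathcomp Require Import finmap boolp classical_sets.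

(** The operations on external numbers are Minkowski operations, so whatever is
    computed from real representatives of some external numbers lies in the
    external number computed from them ([mem_ext_det], [mem_ext_sum]). For a
    sum indexed without repetition the converse holds: every real in the sum is
    the sum of representatives of the terms ([ext_sum_split]). Since an external
    number is a neutrix as soon as it contains 0, the linear dependence of
    external vectors is the linear dependence of suitable representatives.
    The two inequalities then reduce to linear algebra over the reals.

    - [minor_rank M <= row_rank M]: take a zeroless minor of order k. If its
      k rows in M were equal somewhere or linearly dependent, then its
      submatrix would have a representative with two equal rows, or with a
      nontrivial relation between its rows, chosen column by column. The
      determinant of this representative is 0, and it belongs to the minor,
      which is zeroless.

    - [row_rank M <= \rank P] for every representative matrix P: among more
      than [\rank P] rows of M, the corresponding rows of P satisfy a nontrivial
      linear relation. With the same coefficients, the combination of the rows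
      of M contains 0 in every coordinate, so it is a neutrix vector.

    When the strict rank is defined, some P has rank [minor_rank M], and the two
    inequalities close up. *)

Set Implicit Arguments.
Unset Strict Implicit.
Unset Printing Implicit Defensive.

Import GRing.Theory.
Local Open Scope ring_scope.

Section Representatives.
Variable R : rcfType.
Implicit Types (al be : extnum R) (x y : R).

Lemma mem_ext_add al be x y :
  ext_set al x -> ext_set be y -> ext_set (al + be) (x + y).
Proof. by move=> alx bey; exists x => //; exists y. Qed.

Lemma mem_ext_mul al be x y :
  ext_set al x -> ext_set be y -> ext_set (ext_mul al be) (x * y).
Proof. by move=> alx bey; exists x => //; exists y. Qed.

Lemma mem_ext_sum (I : Type) (s : seq I) (P : pred I)
    (F : I -> extnum R) (f : I -> R) :
  (forall i, P i -> ext_set (F i) (f i)) ->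
  ext_set (\sum_(i <- s | P i) F i) (\sum_(i <- s | P i) f i).
Proof.
move=> Ff; apply: (big_ind2 (fun al x => ext_set al x)) => //.
by move=> al x be y; apply: mem_ext_add.
Qed.

(** Repetitions have to be excluded: a Minkowski sum of an external number with
    itself allows a different representative for each occurrence. *)
Lemma ext_sum_split (I : eqType) (s : seq I) (F : I -> extnum R) x :
  uniq s -> ext_set (\sum_(i <- s) F i) x ->
  exists2 f : I -> R, forall i, i \in s -> ext_set (F i) (f i)
                    & x = \sum_(i <- s) f i.
Proof.
elim: s x => [|i s IHs] x.
  by rewrite big_nil => _ ->; exists (fun=> 0) => //; rewrite big_nil.
rewrite big_cons => /andP[si us] [y Fy [z /(IHs _ us)[f Ff ->] <-]].
exists (fun j => if j == i then y else f j) => [j|].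
  by rewrite inE; case: eqVneq => [-> //|_] /=; exact: Ff.
rewrite big_cons eqxx; congr (_ + _); apply: eq_big_seq => j js.
by case: eqVneq => // ji; rewrite -ji js in si.
Qed.

Lemma ext_nonempty al : exists x, ext_set al x.
Proof. by have [a [A [[A0 _ _] ->]]] := extnumP al; exists (a + 0), 0. Qed.

(** If a + A contains 0 then -a, hence a, lies in A, so that a + A = A. *)
Lemma neutrix_ext0 al : ext_set al 0 -> is_neutrix (ext_set al).
Proof.
have [a [A [nA ->]]] := extnumP al; move=> [u Au /eqP].
rewrite addr_eq0 => /eqP ->.
suff -> : [set - u + x | x in A]%classic = A by [].
have [_ AB _] := nA.
apply/seteqP; split=> [_ [x Ax <-]|x Ax]; first by rewrite addrC; exact: AB.
by exists (x + u); [exact: neutrixD | rewrite addrCA addNr addr0].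
Qed.

Lemma mem_ext_det k (N : 'M[extnum R]_k) (Q : 'M[R]_k) :
  is_representative N Q -> ext_set (ext_det N) (\det Q).
Proof.
move=> NQ; apply: mem_ext_sum => s _; apply: mem_ext_mul => //.
apply: (big_ind2 (fun al x => ext_set al x)) => //.
by move=> al x be y; apply: mem_ext_mul.
Qed.

Lemma zeroless_det_neq0 k (N : 'M[extnum R]_k) (Q : 'M[R]_k) :
  zeroless (ext_det N) -> is_representative N Q -> \det Q != 0.
Proof. by move=> N0 /mem_ext_det NQ; apply/eqP => Q0; apply: N0; rewrite -Q0. Qed.

End Representatives.

Section RankInequalities.
Variables (R : rcfType) (m n : nat) (M : 'M[extnum R]_(m, n)).

(** Choosing the representative of an entry as a function of the external
    number alone gives equal representatives to equal rows. *)
Lemma zeroless_minor_row_inj k (f : 'I_k -> 'I_m) (g : 'I_k -> 'I_n) :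
  zeroless (ext_det (mxsub f g M)) -> injective (fun i => row (f i) M).
Proof.
move=> N0 i1 i2 eqM; apply/eqP/negPn/negP => i12.
have [c cP] := choice (@ext_nonempty R).
pose Q := \matrix_(i, j) c (mxsub f g M i j).
have NQ : is_representative (mxsub f g M) Q by move=> i j; rewrite [Q _ _]mxE.
have /negP := zeroless_det_neq0 N0 NQ; apply.
rewrite (determinant_alternate i12)// => j.
by rewrite !mxE; move/rowP: eqM => /(_ (g j)); rewrite !mxE => ->.
Qed.

(** The addends of the different columns are chosen independently of each other
    in a Minkowski sum, so the columnwise relations, which share their
    coefficients, assemble into one relation between the rows of a real
    representative. *)
Lemma zeroless_minor_independent k (f : 'I_k -> 'I_m) (g : 'I_k -> 'I_n) :
  zeroless (ext_det (mxsub f g M)) ->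
  lin_independent [fset row (f i) M | i : 'I_k]%fset.
Proof.
move=> N0; have inj := zeroless_minor_row_inj N0.
set V := [fset row (f i) M | i : 'I_k]%fset.
have memV i : row (f i) M \in V by apply/imfsetP; exists i.
move=> [t [[xi Vxi txi] [A nA sumA]]].
(* a relation between representatives, for each column separately *)
have rel j : exists y : 'rV[extnum R]_n -> R,
    (forall v, v \in V -> ext_set (v ord0 (g j)) (y v)) /\
    \sum_(v <- V) t v * y v = 0.
  have [+ _ _] := nA (g j).
  rewrite -sumA summxE => /(ext_sum_split (fset_uniq V))[z zP z0].
  have tz v : exists y, v \in V -> ext_set (v ord0 (g j)) y /\ t v * y = z v.
    case vV: (v \in V); last by exists 0.
    have := zP v vV; rewrite mxE => -[_ -> [y vy <-]].
    by exists y.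
  have [y yP] := choice tz.
  exists y; split=> [v /yP[]//|].
  by rewrite [RHS]z0; apply: eq_big_seq => v /yP[].
have [y yP] := choice rel.
pose Q := \matrix_(i, j) y j (row (f i) M).
have NQ : is_representative (mxsub f g M) Q.
  by move=> i j; have [/(_ _ (memV i))] := yP j; rewrite !mxE.
have /negP := zeroless_det_neq0 N0 NQ; apply.
apply/det0P; exists (\row_i t (row (f i) M)).
  have /imfsetP[i _ xiE] := Vxi.
  by apply: contraNneq txi => /rowP/(_ i); rewrite !mxE -xiE => ->.
apply/rowP => j; rewrite !mxE -[RHS](yP j).2.
rewrite big_imfset/=; last by move=> i1 i2 _ _ /inj.
by rewrite big_enum; apply: eq_bigr => i _; rewrite !mxE.
Qed.

Lemma zeroless_minor_leq_row_rank k :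
  has_zeroless_minor M k -> (k <= row_rank M)%N.
Proof.
move=> [f [g [_ _ N0]]].
set V := [fset row (f i) M | i : 'I_k]%fset.
have cardV : #|` V| = k.
  by rewrite card_imfset/= -?cardE ?card_ord//; exact: zeroless_minor_row_inj N0.
rewrite -cardV; apply: leq_bigmax_seq.
  rewrite fpowersetE; apply/fsubsetP => _ /imfsetP[i _ ->].
  by apply/imfsetP; exists (f i).
exact/asboolP/(zeroless_minor_independent N0).
Qed.

Lemma minor_rank_leq_row_rank : (minor_rank M <= row_rank M)%N.
Proof.
by apply/bigmax_leqP => k /asboolP; exact: zeroless_minor_leq_row_rank.
Qed.

(** The coefficients of a relation between representatives also serve for the
    external rows: each coordinate of the combination then contains 0. *)
Lemma lin_dependent_of_rank (P : 'M[R]_(m, n)) (V : {fset 'rV[extnum R]_n}) :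
  is_representative M P -> (V `<=` row_set M)%fset -> (\rank P < #|` V|)%N ->
  lin_dependent V.
Proof.
move=> MP /fsubsetP VM rkV.
have idx (v : V) : exists i, row i M = val v.
  by have /imfsetP[i _ ->] := VM _ (valP v); exists i.
have [phi phiP] := choice idx.
(* Q has more rows than the rank of P, which bounds its own rank *)
pose Q := rowsub (phi \o enum_val) P : 'M_(#|{: V}|, n).
have [u u0 uQ] : exists2 u : 'rV_#|{: V}|, u != 0 & u *m Q = 0.
  apply: contrapT => nou; have /eqP rkQ : row_free Q.
    apply: inj_row_free => u uQ; apply/eqP/negPn/negP => u0.
    by apply: nou; exists u.
  move: rkV; rewrite cardfE -rkQ ltnNge => /negP; apply.
  by apply: mxrankS; apply: rowsub_sub.
pose t v := if insub v is Some v' then u ord0 (enum_rank (v' : V)) else 0.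
have tV (v : V) : t (val v) = u ord0 (enum_rank v) by rewrite /t valK.
exists t; split.
  have /rV0Pn[i ui] := u0.
  exists (val (enum_val i : V)); first exact: valP.
  by rewrite tV enum_valK.
exists (\sum_(xi <- V) ext_scale (t xi) xi) => // j.
apply: neutrix_ext0; rewrite summxE big_seq_fsetE/=.
have <- : \sum_(v : V) t (val v) * P (phi v) j = 0.
  have /rowP/(_ j) := uQ; rewrite !mxE => uQj; rewrite -[RHS]uQj.
  rewrite (reindex (@enum_val _ (mem {: V})))/=; last first.
    by exists enum_rank => v _; rewrite ?enum_valK ?enum_rankK.
  by apply: eq_bigr => i _; rewrite tV enum_valK mxE.
apply: mem_ext_sum => v _; rewrite mxE; apply: mem_ext_mul => //.
by rewrite -phiP mxE; exact: MP.
Qed.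

Lemma row_rank_leq_rank (P : 'M[R]_(m, n)) :
  is_representative M P -> (row_rank M <= \rank P)%N.
Proof.
move=> MP; apply/bigmax_leqP_seq => V; rewrite fpowersetE => VM /asboolP indep.
by rewrite leqNgt; apply/negP => /(lin_dependent_of_rank MP VM).
Qed.

End RankInequalities.

Theorem theorem7p10 (R : rcfType) (hR : nonstandard_reals R)
    (m n : nat) (M : 'M[extnum R]_(m, n)) (r : nat) :
  strict_rank M = Some r -> minor_rank M = row_rank M /\ row_rank M = r.
Proof.
rewrite /strict_rank; case: asboolP => // -[P MP rkP] [<-].
have eq_rank : minor_rank M = row_rank M.
  by apply/eqP; rewrite eqn_leq minor_rank_leq_row_rank -rkP row_rank_leq_rank.
by [].
Qed.
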